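(* Let $\mathcal{M}$ be a Riemannian manifold and let $\{\boldsymbol{c}^{(0)};\boldsymbol{d}^{(1)},\dots,\boldsymbol{d}^{(J)}\}$ and $\{\widetilde{\boldsymbol{c}}^{(0)};\widetilde{\boldsymbol{d}}^{(1)},\dots,\widetilde{\boldsymbol{d}}^{(J)}\}$ be two pyramids of sequences. Let $\mathcal{T}_{\boldsymbol{\alpha}}$ be a subdivision scheme over $\mathcal{M}$ that is stable with constant $S_{\mathcal{T}}$. Then the sequences $\boldsymbol{c}^{(J)}$ and $\widetilde{\boldsymbol{c}}^{(J)}$ reconstructed from the two pyramids by the synthesis iterations $$\boldsymbol{c}^{(\ell)}=\mathcal{T}_{\boldsymbol{\alpha}}\boldsymbol{c}^{(\ell-1)}\oplus\boldsymbol{d}^{(\ell)},\qquad \widetilde{\boldsymbol{c}}^{(\ell)}=\mathcal{T}_{\boldsymbol{\alpha}}\widetilde{\boldsymbol{c}}^{(\ell-1)}\oplus\widetilde{\boldsymbol{d}}^{(\ell)},\qquad \ell=1,\dots,J,$$ satisfy $$\mu(\boldsymbol{c}^{(J)},\widetilde{\boldsymbol{c}}^{(J)})\le L\bigg(\mu(\boldsymbol{c}^{(0)},\widetilde{\boldsymbol{c}}^{(0)})+\sum_{i=1}^{J}\Big(\|\boldsymbol{d}^{(i)}\|_\infty+\|\widetilde{\boldsymbol{d}}^{(i)}\|_\infty\Big)\bigg),$$ with $L=1$ if $S_{\mathcal{T}}\le 1$, and $L=S_{\mathcal{T}}^J$ otherwise.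
   Context: All sequences are bi-infinite, indexed by $\mathbb{Z}$. $\mathcal{M}$ is a Riemannian manifold with geodesic distance $\rho$, and $\mu(\boldsymbol{c},\boldsymbol{m})=\sup_{k\in\mathbb{Z}}\rho(c_k,m_k)$ for $\mathcal{M}$-valued sequences. $\boldsymbol{\alpha}$ is a finitely supported real mask with $\sum_i\alpha_{2i}=\sum_i\alpha_{2i+1}=1$, and $\mathcal{T}_{\boldsymbol{\alpha}}(\boldsymbol{c})_k=\arg\min_{x\in\mathcal{M}}\sum_i\alpha_{k-2i}\,\rho(x,c_i)^2$. Standing assumption: all sequences to which $\mathcal{T}_{\boldsymbol\alpha}$ is applied are admissible, i.e. these minimizers exist and are unique. $\mathcal{T}$ is stable with constant $S_{\mathcal{T}}\ge0$ if $\mu(\mathcal{T}\boldsymbol{c},\mathcal{T}\boldsymbol{m})\le S_{\mathcal{T}}\,\mu(\boldsymbol{c},\boldsymbol{m})$ for all (admissible) $\mathcal{M}$-valued sequences $\boldsymbol{c},\boldsymbol{m}$. $p\oplus v=\exp_p(v)$ for $v\in T_p\mathcal{M}$, applied elementwise. A pyramid consists of an $\mathcal{M}$-valued sequence $\boldsymbol{c}^{(0)}$ and sequences $\boldsymbol{d}^{(\ell)}$ of tangent vectors such that, along the synthesis iterations, $d^{(\ell)}_k\in T_{(\mathcal{T}_{\boldsymbol\alpha}\boldsymbol{c}^{(\ell-1)})_k}\mathcal{M}$ and has norm within the injectivity radius of $\mathcal{M}$ (so $\rho(p\oplus v,p)=\|v\|$ for the vectors involved). $\|\boldsymbol{d}^{(\ell)}\|_\infty=\sup_k\|d^{(\ell)}_k\|$.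 *)

(* Defs.v *)
From mathcomp Require Import all_boot all_order all_algebra.
From mathcomp Require Import all_classical all_reals all_analysis.

Set Implicit Arguments.
Unset Strict Implicit.
Unset Printing Implicit Defensive.
Import Order.TTheory GRing.Theory Num.Theory.
Import numFieldNormedType.Exports.

Local Open Scope classical_set_scope.
Local Open Scope ring_scope.

Section EuclideanSmoothness.
Variables (R : realType) (n : nat).

Definition partial (i : 'I_n) (f : 'rV[R]_n -> R) (x : 'rV[R]_n) : R :=
  'D_(delta_mx 0 i) f x.

(* [f] is of class C^k at the points of [U]; only used for open [U]. *)
Fixpoint Ck (k : nat) (U : set 'rV[R]_n) (f : 'rV[R]_n -> R) : Prop :=
  if k is k'.+1 then
    (forall x, U x -> differentiable f x) /\ forall i, Ck k' U (partial i f)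
  else forall x, U x -> {for x, continuous f}.

Definition smooth (U : set 'rV[R]_n) (f : 'rV[R]_n -> R) : Prop :=
  forall k, Ck k U f.

Definition vsmooth (m : nat) (U : set 'rV[R]_n) (f : 'rV[R]_n -> 'rV[R]_m) :
  Prop := forall j, smooth U (fun x => f x 0 j).

Definition bilin (G : 'M[R]_n) (u w : 'rV[R]_n) : R := (u *m G *m w^T) 0 0.

(* Christoffel symbols of the second kind, Gamma^k_{ij}, of the metric [G]. *)
Definition christoffel (G : 'rV[R]_n -> 'M[R]_n) (k i j : 'I_n)
    (x : 'rV[R]_n) : R :=
  2^-1 * \sum_l invmx (G x) k l *
    (partial i (fun y => G y j l) x + partial j (fun y => G y i l) x
     - partial l (fun y => G y i j) x).

End EuclideanSmoothness.

(* A smooth n-manifold (Hausdorff, second countable, with a smooth atlas)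
   with a smooth Riemannian metric.  [phi i] and [psi i] are total functions,
   mutually inverse homeomorphisms between the open sets [dom i] and
   [phi i @` dom i]; their values elsewhere are irrelevant.  [metric i x] is the
   matrix (g_{ab}(x)) in the chart [i].  [chart_at p] selects a chart around
   [p], in which tangent vectors at [p] are written. *)
Record riemannianManifold (R : realType) (n : nat) := RiemannianManifold {
  carrier :> topologicalType ;
  manifold_hausdorff : hausdorff_space carrier ;
  manifold_second_countable : @second_countable carrier ;
  chart : Type ;
  dom : chart -> set carrier ;
  phi : chart -> carrier -> 'rV[R]_n ;
  psi : chart -> 'rV[R]_n -> carrier ;
  dom_open : forall i, open (dom i) ;
  codom_open : forall i, open (phi i @` dom i) ;
  phiK : forall i p, dom i p -> psi i (phi i p) = p ;
  phi_continuous : forall i p, dom i p -> {for p, continuous (phi i)} ;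
  psi_continuous : forall i x, (phi i @` dom i) x -> {for x, continuous (psi i)} ;
  chart_at : carrier -> chart ;
  chart_atP : forall p, dom (chart_at p) p ;
  transition_smooth : forall i j,
    vsmooth (phi i @` (dom i `&` dom j)) (phi j \o psi i) ;
  metric : chart -> 'rV[R]_n -> 'M[R]_n ;
  metric_smooth : forall i a b,
    smooth (phi i @` dom i) (fun x => metric i x a b) ;
  metric_sym : forall i x, (phi i @` dom i) x -> (metric i x)^T = metric i x ;
  metric_posdef : forall i x, (phi i @` dom i) x ->
    forall u, u != 0 -> 0 < bilin (metric i x) u u ;
  metric_transition : forall i j x, (phi i @` (dom i `&` dom j)) x ->
    forall u w, bilin (metric i x) u w =
      bilin (metric j ((phi j \o psi i) x))
        ('D_u (phi j \o psi i) x) ('D_w (phi j \o psi i) x)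
}.

Section Riemannian.
Variables (R : realType) (n : nat) (M : riemannianManifold R n).

(* The tangent space at [p], in the coordinates of the chart [chart_at p]. *)
Definition tangent (p : M) : Type := 'rV[R]_n.

Definition tnorm (p : M) (v : tangent p) : R :=
  Num.sqrt (bilin (metric (chart_at p) (phi (chart_at p) p)) v v).

Definition in_chart (i : chart M) (g : R -> M) : R -> 'rV[R]_n := phi i \o g.

Definition velocity (g : R -> M) (t : R) : tangent (g t) :=
  derive1 (in_chart (chart_at (g t)) g) t.

Definition C1_curve (a b : R) (g : R -> M) : Prop :=
  forall t, a <= t <= b ->
    {for t, continuous g} /\
    forall i, dom i (g t) ->
      (\forall s \near t, derivable (in_chart i g) s 1) /\
      {for t, continuous (derive1 (in_chart i g))}.

Definition curve_length (a b : R) (g : R -> M) : \bar R :=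
  (\int[lebesgue_measure]_(t in `[a, b]) (tnorm (velocity g t))%:E)%E.

(* [path_length p q l]: some piecewise C^1 curve from [p] to [q], given as a
   finite succession of C^1 arcs, has length [l]. *)
Inductive path_length : M -> M -> \bar R -> Prop :=
| path_length_nil p : path_length p p 0%E
| path_length_cons (a b : R) (g : R -> M) (q : M) (l : \bar R) :
    a <= b -> C1_curve a b g -> path_length (g b) q l ->
    path_length (g a) q (curve_length a b g + l)%E.

(* The geodesic distance, +oo between distinct connected components. *)
Definition rho (p q : M) : \bar R := ereal_inf [set l | path_length p q l].

(* The equations x''^k + Gamma^k_{ij} x'^i x'^j = 0 on the open interval
   ]a, b[, in every chart. *)
Definition geodesic (a b : R) (g : R -> M) : Prop :=
  forall t, a < t < b ->
    {for t, continuous g} /\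
    forall i, dom i (g t) -> let x := in_chart i g in let x' := derive1 x in
      [/\ \forall s \near t, derivable x s 1,
          derivable x' t 1 &
          forall k, derive1 x' t 0 k +
            \sum_i1 \sum_i2 christoffel (metric i) k i1 i2 (x t)
              * x' t 0 i1 * x' t 0 i2 = 0].

Definition exp_curve (p : M) (v : tangent p) (g : R -> M) : Prop :=
  [/\ exists2 e : R, 0 < e & geodesic (- e) (1 + e) g,
      g 0 = p & derive1 (in_chart (chart_at p) g) 0 = v].

Definition exp_domain (p : M) : set (tangent p) :=
  [set v | exists g, exp_curve v g].

(* exp_p(v) is the time-1 point of the geodesic with initial velocity [v],
   for [v] in [exp_domain p] (and a dummy value otherwise). *)
Definition exp_at (p : M) (v : tangent p) : M :=
  xget p [set g 1 | g in [set g | exp_curve v g]].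

(* exp_p is defined on the ball of radius [r] of the tangent space at [p], and
   is a diffeomorphism from it onto an open subset. *)
Definition exp_diffeo_ball (p : M) (r : R) : Prop :=
  let B : set 'rV[R]_n := [set v | tnorm (v : tangent p) < r] in
  let e : 'rV[R]_n -> M := @exp_at p in
  [/\ B `<=` @exp_domain p,
      open (e @` B),
      forall v, B v -> {for v, continuous e},
      forall i, vsmooth (B `&` e @^-1` dom i) (phi i \o e) &
      exists log : M -> 'rV[R]_n,
        (forall v, B v -> log (e v) = v) /\
        (forall i, vsmooth (phi i @` (dom i `&` e @` B)) (log \o psi i))].

Definition inj_radius_at (p : M) : \bar R :=
  ereal_sup [set r%:E | r in [set r : R | 0 <= r /\ exp_diffeo_ball p r]].

Definition inj_radius : \bar R := ereal_inf (range inj_radius_at).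

Definition mu (c m : int -> M) : \bar R :=
  ereal_sup (range (fun k => rho (c k) (m k))).

Definition subdivision_mask (alpha : int -> R) : Prop :=
  [/\ finite_set [set i | alpha i != 0],
      \sum_(i \in [set: int]) alpha (2 * i) = 1 &
      \sum_(i \in [set: int]) alpha (2 * i + 1) = 1].

(* The points at finite distance from the data entering the k-th average: the
   only competitors in the minimization.  It is the whole of [M] as soon as [M]
   is connected. *)
Definition competitor (alpha : int -> R) (c : int -> M) (k : int) : set M :=
  [set x | forall i, alpha (k - 2 * i) != 0 -> (rho x (c i) < +oo)%E].

Definition objective (alpha : int -> R) (c : int -> M) (k : int) (x : M) : R :=
  \sum_(i \in [set: int]) alpha (k - 2 * i) * fine (rho x (c i)) ^+ 2.

Definition minimizer (alpha : int -> R) (c : int -> M) (k : int) : set M :=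
  [set x | competitor alpha c k x /\
    forall y, competitor alpha c k y ->
      objective alpha c k x <= objective alpha c k y].

Definition admissible (alpha : int -> R) (c : int -> M) : Prop :=
  forall k, exists x, minimizer alpha c k = [set x].

(* Meaningful for admissible [c] only; [c k] is a dummy default. *)
Definition refine (alpha : int -> R) (c : int -> M) : int -> M :=
  fun k => xget (c k) (minimizer alpha c k).

(* The restriction to mu(c, m) < +oo only matters when S = 0, where S * +oo
   has no meaning (it is 0 in the library); for S > 0 the bound is vacuous
   when mu(c, m) = +oo. *)
Definition stable (alpha : int -> R) (S : R) : Prop :=
  0 <= S /\
  forall c m : int -> M, admissible alpha c -> admissible alpha m ->
    (mu c m < +oo)%E ->
    (mu (refine alpha c) (refine alpha m) <= S%:E * mu c m)%E.

Record tangent_vector := TangentVector {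
  foot : M ;
  vec : tangent foot
}.

Definition tvnorm (v : tangent_vector) : \bar R := (tnorm (vec v))%:E.

Definition supnorm (d : int -> tangent_vector) : \bar R :=
  ereal_sup (range (fun k => tvnorm (d k))).

(* exp_p(v); meaningful when [foot v = p]. *)
Definition oplus (p : M) (v : tangent_vector) : M :=
  exp_at (vec v : tangent p).

(* [details P l] is d^(l), for l >= 1. *)
Record pyramid := Pyramid {
  coarse : int -> M ;
  details : nat -> int -> tangent_vector
}.

Fixpoint synthesis (alpha : int -> R) (P : pyramid) (l : nat) : int -> M :=
  if l is l'.+1 then
    fun k => oplus (refine alpha (synthesis alpha P l') k) (details P l k)
  else coarse P.

(* The standing assumptions on a pyramid with levels 1, ..., J. *)
Definition pyramid_ok (alpha : int -> R) (P : pyramid) (J : nat) : Prop :=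
  forall l, (l < J)%N ->
    admissible alpha (synthesis alpha P l) /\
    forall k, let v := details P l.+1 k in
      [/\ foot v = refine alpha (synthesis alpha P l) k,
          exp_domain (vec v) &
          (tvnorm v <= inj_radius)%E].

End Riemannian.

(* Main.v *)
Require Import Defs.
From mathcomp Require Import all_boot all_order all_algebra.
From mathcomp Require Import all_classical all_reals all_analysis.
From mathcomp Require Import ring lra.
Import Order.TTheory GRing.Theory Num.Theory.
Import numFieldNormedType.Exports.
Local Open Scope classical_set_scope.
Local Open Scope ring_scope.

(* A geodesic has constant speed: in a chart, the Christoffel symbols are exactly
   what makes the derivative of g(x', x') vanish along a solution of
   x'' + Gamma(x', x') = 0.  The time-1 geodesic from p to exp_p(v), and its
   reversal, are therefore paths of length |v|, and the distance between
   exp_p(v) and exp_q(w) is at most rho(p, q) + |v| + |w|.  Taking the supremum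
   over the indices and using stability,
     mu(c^(l), c~^(l)) <= S mu(c^(l-1), c~^(l-1)) + |d^(l)| + |d~^(l)|,
   and an induction on l with T = max(S, 1) >= 1 absorbs the details into the
   factor T^l. *)

(** * Calculus in one chart: the metric as a bilinear form, and energy along geodesics *)

Section EuclideanCalculus.
Context {R : realType} {n : nat}.
Implicit Types (x : R -> 'rV[R]_n) (u v w : 'rV[R]_n) (G : 'M[R]_n).

Lemma bilinE G u w : bilin G u w = \sum_a \sum_b G a b * u 0 a * w 0 b.
Proof.
rewrite /bilin mxE exchange_big; apply: eq_bigr => b _; rewrite !mxE mulr_suml.
by apply: eq_bigr => a _; rewrite [u 0 a * _]mulrC.
Qed.

Lemma bilinC G u w : G^T = G -> bilin G u w = bilin G w u.
Proof.
move=> GT; rewrite /bilin -[RHS](mxE trmx_key (fun i j => _ j i)) -/(trmx _).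
by rewrite !trmx_mul trmxK GT mulmxA.
Qed.

Lemma bilinNN G u : bilin G (- u) (- u) = bilin G u u.
Proof. by rewrite /bilin mulNmx linearN mulmxN mulNmx opprK. Qed.

(** A vector in the kernel would have zero energy. Invertibility is what lets the metric cancel the
    inverse metric inside the Christoffel symbols. *)
Lemma posdef_unitmx G :
  (forall u, u != 0 -> 0 < bilin G u u) -> G \in unitmx.
Proof.
move=> Gpos; rewrite unitmxE unitfE; apply/negP => /det0P[u u0 uG].
by have := Gpos u u0; rewrite /bilin uG mul0mx mxE ltxx.
Qed.

Lemma derive_partial (f : 'rV[R]_n -> R) y v : differentiable f y ->
  'D_v f y = \sum_l v 0 l * partial l f y.
Proof.
move=> df; rewrite deriveE// {1}[v]row_sum_delta linear_sum.
by apply: eq_bigr => l _; rewrite linearZ /partial deriveE.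
Qed.

Lemma is_derive_comp_curve (V W : normedModType R) (f : V -> W) (x : R -> V) t :
  differentiable f (x t) -> derivable x t 1 ->
  is_derive t 1 (f \o x) ('D_(derive1 x t) f (x t)).
Proof.
move=> df /derivable1_diffP dx.
apply: DeriveDef; first exact/diff_derivable/differentiable_comp.
rewrite deriveE; last exact: differentiable_comp.
by rewrite diff_comp// [RHS]deriveE// derive1E'.
Qed.

Lemma is_derive_coord x t j : derivable x t 1 ->
  is_derive t 1 (fun s => x s 0 j) (derive1 x t 0 j).
Proof.
move=> dx; apply: DeriveDef; first exact: (derivable_mxP _ _ _).1 dx _ _.
by rewrite derive1E derive_mx// mxE.
Qed.

(** By the product rule the derivative is [Q + 2 bilin G v w], where [Q] differentiates the metric
    coefficients along [v]; the geodesic equation turns the second term into [- Q]. *)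
Lemma geodesic_energy (G : 'rV[R]_n -> 'M[R]_n) x t :
  (forall a b, differentiable (fun y => G y a b) (x t)) ->
  (G (x t))^T = G (x t) -> G (x t) \in unitmx ->
  derivable x t 1 -> derivable (derive1 x) t 1 ->
  (forall k, derive1 (derive1 x) t 0 k +
     \sum_i \sum_j christoffel G k i j (x t)
       * derive1 x t 0 i * derive1 x t 0 j = 0) ->
  is_derive t 1 (fun s => bilin (G (x s)) (derive1 x s) (derive1 x s)) 0.
Proof.
move=> dG GT Gu dx ddx geo.
set v := derive1 x t; set w := derive1 (derive1 x) t.
(* The equation says G w = - q / 2; of the three terms of <v, q>, reindexing
   turns two into Q and the last into - Q, so that 2 <v, G w> = - Q. *)
pose C i j l := partial i (fun y => G y j l) (x t) +
  partial j (fun y => G y i l) (x t) - partial l (fun y => G y i j) (x t).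
pose q : 'rV[R]_n := \row_l \sum_i \sum_j C i j l * v 0 i * v 0 j.
pose Q := \sum_l \sum_a \sum_b
  v 0 l * partial l (fun y => G y a b) (x t) * v 0 a * v 0 b.
have wE : w^T = - 2^-1 *: (invmx (G (x t)) *m q^T).
  apply/colP => k; rewrite !mxE; move/eqP: (geo k); rewrite addr_eq0 => /eqP ->.
  rewrite mulNr; congr (- _); rewrite mulr_sumr.
  under [RHS]eq_bigr => l _ do rewrite !mxE mulr_sumr mulr_sumr.
  rewrite [RHS]exchange_big; apply: eq_bigr => i _ /=.
  under [RHS]eq_bigr => l _ do rewrite mulr_sumr mulr_sumr.
  rewrite [RHS]exchange_big; apply: eq_bigr => j _ /=.
  rewrite /christoffel mulr_sumr !mulr_suml; apply: eq_bigr => l _.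
  by rewrite /C -/v; ring.
have vwE : bilin (G (x t)) v w = - 2^-1 * \sum_l v 0 l * q 0 l.
  rewrite /bilin wE -scalemxAr mulmxA mulmxK// !mxE; congr (_ * _).
  by apply: eq_bigr => l _; rewrite !mxE.
have qE : \sum_l v 0 l * q 0 l = Q.
  have -> : \sum_l v 0 l * q 0 l =
    (\sum_l \sum_i \sum_j v 0 l * partial i (fun y => G y j l) (x t) * v 0 i * v 0 j)
    + (\sum_l \sum_i \sum_j v 0 l * partial j (fun y => G y i l) (x t) * v 0 i * v 0 j)
    - Q.
    rewrite /Q -big_split -sumrB; apply: eq_bigr => l _.
    rewrite mxE mulr_sumr -big_split -sumrB; apply: eq_bigr => i _.
    rewrite mulr_sumr -big_split -sumrB; apply: eq_bigr => j _.
    by rewrite /C /=; ring.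
  have -> : \sum_l \sum_i \sum_j
      v 0 l * partial i (fun y => G y j l) (x t) * v 0 i * v 0 j = Q.
    rewrite /Q exchange_big; apply: eq_bigr => i _.
    rewrite exchange_big; apply: eq_bigr => j _; apply: eq_bigr => l _.
    by ring.
  have -> : \sum_l \sum_i \sum_j
      v 0 l * partial j (fun y => G y i l) (x t) * v 0 i * v 0 j = Q.
    under eq_bigr => l _ do rewrite exchange_big.
    rewrite /Q exchange_big; apply: eq_bigr => j _.
    rewrite exchange_big; apply: eq_bigr => i _; apply: eq_bigr => l _.
    by ring.
  by rewrite addrK.
(* The energy becomes a sum of products of functions, the shape to which the derivation rules for
   sums and products apply. *)
have -> : (fun s => bilin (G (x s)) (derive1 x s) (derive1 x s)) =
    \sum_a \sum_b ((fun s => G (x s) a b) * (fun s => derive1 x s 0 a) *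
                   (fun s => derive1 x s 0 b)).
  apply/funext => s; rewrite bilinE fct_sumE; apply: eq_bigr => a _.
  by rewrite fct_sumE.
have dgab a b : is_derive t 1 (fun s => G (x s) a b)
    ('D_v (fun y => G y a b) (x t)).
  exact: is_derive_comp_curve (dG a b) dx.
apply: is_derive_eq.
  apply: is_derive_sum => a; apply: is_derive_sum => b.
  apply: is_deriveM; last exact: is_derive_coord.
  by apply: is_deriveM; exact: is_derive_coord.
rewrite /= -/v -/w.
(* One summand for each factor that the product rule differentiates: the coefficients of [G], then
   either copy of [x']. *)
transitivity (Q + (bilin (G (x t)) v w + bilin (G (x t)) w v)); last first.
  by rewrite (bilinC _ w v)// vwE qE; field.
rewrite !bilinE /Q [X in X + _]exchange_big /= -!big_split.
apply: eq_bigr => a _ /=.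
rewrite [X in X + _]exchange_big /= -!big_split; apply: eq_bigr => b _ /=.
rewrite derive_partial// /GRing.scale /=.
set S := \sum_l _ * _.
rewrite -!mulr_suml -/S.
change (G (x t) a b * v 0 a * w 0 b + v 0 b * (G (x t) a b * w 0 a + v 0 a * S) =
  S * v 0 a * v 0 b + (G (x t) a b * v 0 a * w 0 b + G (x t) a b * w 0 a * v 0 b)).
by ring.
Qed.

End EuclideanCalculus.

(** Smoothness of transition maps is given coordinate by coordinate, while the chain rule needs the
    whole map. *)
Lemma differentiable_rowP (R : realType) (V : normedModType R) (m : nat)
    (f : V -> 'rV[R]_m) y :
  (forall j, differentiable (fun z => f z 0 j) y) -> differentiable f y.
Proof.
move=> df.
have -> : f = \sum_(j < m) (fun z => f z 0 j *: (delta_mx 0 j : 'rV[R]_m)).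
  by apply/funext => z; rewrite fct_sumE {1}[f z]row_sum_delta.
apply: differentiable_sum => j.
exact: differentiableZl.
Qed.

(** * Speed of a curve on the manifold, and its constancy along geodesics *)

Section Curves.
Context {R : realType} {n : nat} {M : riemannianManifold R n}.
Implicit Types (p q : M) (g : R -> M) (i j : chart M) (s t : R).

Lemma near_dom g t i : {for t, continuous g} -> dom i (g t) ->
  \forall s \near t, dom i (g s).
Proof.
move=> cg di; apply: cg; apply: open_nbhs_nbhs; split=> //; exact: dom_open.
Qed.

(** Near [t] the curve stays in [dom i], so its expression in chart [j] is the transition map
    composed with its expression in chart [i], and the chain rule applies. *)
Lemma velocity_transition g t i j :
  {for t, continuous g} -> dom i (g t) -> dom j (g t) ->
  derivable (in_chart i g) t 1 ->
  derive1 (in_chart j g) t =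
    'D_(derive1 (in_chart i g) t) (phi j \o psi i) (in_chart i g t).
Proof.
move=> cg di dj dx.
rewrite derive1E -(@near_eq_derive _ _ _ ((phi j \o psi i) \o in_chart i g)).
  apply: derive_val; apply: is_derive_comp_curve dx.
  apply: differentiable_rowP => k.
  have [+ _] := transition_smooth i j k 1%N; apply.
  by exists (g t).
near=> s; rewrite /in_chart /= phiK//.
by near: s; exact: near_dom.
Unshelve. all: by end_near. Qed.

(** The square of the speed, computed in the selected chart at [g t], which may jump as [t]
    varies. *)
Definition speed2 g t : R :=
  bilin (metric (chart_at (g t)) (phi (chart_at (g t)) (g t)))
    (velocity g t) (velocity g t).

(** The metric is invariant under transition maps, so the speed can be differentiated in one fixed
    chart. *)
Lemma speed2_chart g t i :
  {for t, continuous g} -> dom i (g t) -> derivable (in_chart i g) t 1 ->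
  speed2 g t = bilin (metric i (in_chart i g t))
    (derive1 (in_chart i g) t) (derive1 (in_chart i g) t).
Proof.
move=> cg di dx; set j := chart_at (g t).
have dj : dom j (g t) by exact: chart_atP.
rewrite (@metric_transition _ _ _ i j); last by exists (g t).
by rewrite -velocity_transition//= /in_chart /= phiK.
Qed.

Lemma geodesic_is_derive_speed2 a b g t : geodesic a b g -> a < t < b ->
  is_derive t 1 (speed2 g) 0.
Proof.
move=> geo tab; set i := chart_at (g t).
have di : dom i (g t) by exact: chart_atP.
have [cg /(_ i di)[ndx ddx eqn]] := geo t tab.
have Ux : (phi i @` dom i) (in_chart i g t) by exists (g t).
(* Near [t], the varying chart of [speed2] is exchanged for the fixed chart [i]. *)
apply: (@near_eq_is_derive _ _ _ (fun s => bilin (metric i (in_chart i g s))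
    (derive1 (in_chart i g) s) (derive1 (in_chart i g) s))); last first.
  apply: (@geodesic_energy _ _ (metric i) (in_chart i g) t).
  - by move=> a' b'; have [+ _] := metric_smooth i a' b' 1%N; exact.
  - exact: Defs.metric_sym.
  - by apply: posdef_unitmx => u; exact: metric_posdef.
  - exact: nbhs_singleton ndx.
  - exact: ddx.
  - exact: eqn.
near=> s.
have sab : a < s < b.
  by have : s \in `]a, b[ by near: s; apply: near_in_itvoo; rewrite in_itv.
have dis : dom i (g s) by near: s; exact: near_dom.
have [cgs /(_ i dis)[ndxs _ _]] := geo s sab.
have dxs := nbhs_singleton ndxs.
exact: (esym (speed2_chart g s i cgs dis dxs)).
Unshelve. all: by end_near. Qed.

(** Mean value theorem with zero derivative. *)
Lemma geodesic_speed2_cst a b g s t : geodesic a b g ->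
  a < s -> s <= t -> t < b -> speed2 g t = speed2 g s.
Proof.
move=> geo sa st tb; apply/eqP; rewrite -subr_eq0; apply/eqP.
have inab u : u \in `[s, t] -> a < u < b.
  by rewrite in_itv/= => /andP[su ut]; rewrite (lt_le_trans sa) ?(le_lt_trans ut).
have [||c _ ->] := @MVT_segment _ (speed2 g) (fun=> 0) s t st.
- move=> u /subset_itv_oo_cc uu; apply: geodesic_is_derive_speed2 geo _.
  exact: inab.
- apply: derivable_within_continuous => u /inab uab.
  by have [] := geodesic_is_derive_speed2 _ _ _ _ geo uab.
- by rewrite mul0r.
Qed.

End Curves.

(** * Reversed curves, lengths of paths and the geodesic distance *)

Lemma is_derive_reverse (R : realType) (W : normedModType R) (x : R -> W) t :
  derivable x (1 - t) 1 ->
  is_derive t 1 (fun s => x (1 - s)) (- derive1 x (1 - t)).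
Proof.
move=> /[dup] dx /derivable1_diffP diffx.
have drev : is_derive t 1 (fun s : R => 1 - s) (- 1).
  by have := is_deriveB (is_derive_cst (1 : R) t 1) (is_derive_id t (1 : R));
    rewrite sub0r.
have rev1 : derive1 (fun s : R => 1 - s) t = - 1.
  by rewrite derive1E; exact: derive_val.
rewrite (_ : - _ = 'D_(derive1 (fun s : R => 1 - s) t) x (1 - t)).
  exact: is_derive_comp_curve.
by rewrite rev1 deriveE// linearN derive1E'.
Qed.

Section Lengths.
Context {R : realType} {n : nat} {M : riemannianManifold R n}.
Implicit Types (p q : M) (g : R -> M) (i j : chart M) (s t : R).

(** In a chart, [x'] is derivable at every time of the open interval, hence continuous there. *)
Lemma geodesic_C1 a b g s t :
  geodesic a b g -> a < s -> t < b -> C1_curve s t g.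
Proof.
move=> geo sa tb u /andP[su ut].
have uab : a < u < b by rewrite (lt_le_trans sa) ?(le_lt_trans ut).
have [cg dg] := geo u uab; split; first exact: cg.
move=> i /dg[ndx ddx _]; split; first exact: ndx.
by apply: differentiable_continuous; apply/derivable1_diffP.
Qed.

(** Paths are directed, and a detour from exp_p(v) must first run back to p. *)
Definition reverse g t := g (1 - t).

Lemma cvg_reverse t : 1 - s @[s --> t] --> 1 - t.
Proof. by apply: cvgB; [exact: cvg_cst|exact: cvg_id]. Qed.

Lemma near_reverse (P : R -> Prop) t :
  (\forall s \near 1 - t, P s) -> \forall s \near t, P (1 - s).
Proof. exact: cvg_reverse. Qed.

Lemma derive1_in_chart_reverse g i t : derivable (in_chart i g) (1 - t) 1 ->
  derive1 (in_chart i (reverse g)) t = - derive1 (in_chart i g) (1 - t).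
Proof.
by move=> dx; rewrite derive1E; have [_ ->] := is_derive_reverse _ _ _ _ dx.
Qed.

Lemma C1_curve_reverse g : C1_curve 0 1 g -> C1_curve 0 1 (reverse g).
Proof.
move=> C1 t t01.
have /C1[cg dg] : 0 <= 1 - t <= 1 by move: t01; lra.
split; first exact: cvg_comp (cvg_reverse t) cg.
move=> i /dg[ndx cdx].
have ndx' : \forall s \near t, derivable (in_chart i g) (1 - s) 1.
  exact: (near_reverse (fun s => derivable (in_chart i g) s 1)).
split.
  apply: filterS ndx' => s dxs.
  exact: (@ex_derive _ _ _ _ _ _ _ (is_derive_reverse _ _ _ _ dxs)).
have cN : - derive1 (in_chart i g) (1 - s) @[s --> t] -->
    - derive1 (in_chart i g) (1 - t).
  by apply: cvgN; exact: cvg_comp (cvg_reverse t) cdx.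
rewrite -(derive1_in_chart_reverse _ _ _ (nbhs_singleton ndx)) in cN.
(* The formula for the reversed derivative holds on a whole neighbourhood of [t], so it passes to
   the limit. *)
apply: cvg_trans cN; apply: near_eq_cvg; apply: filterS ndx' => s dxs.
exact: esym (derive1_in_chart_reverse _ _ _ dxs).
Qed.

Lemma speed2_reverse g t : C1_curve 0 1 g -> 0 <= t <= 1 ->
  speed2 (reverse g) t = speed2 g (1 - t).
Proof.
move=> C1 t01.
have /C1[_ /(_ _ (chart_atP _))[ndx _]] : 0 <= 1 - t <= 1 by move: t01; lra.
rewrite /speed2 /velocity derive1_in_chart_reverse.
  by rewrite bilinNN.
exact: nbhs_singleton ndx.
Qed.

Lemma path_length_cst_speed g c : C1_curve 0 1 g ->
  (forall t, 0 <= t <= 1 -> speed2 g t = c) ->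
  path_length (g 0) (g 1) (Num.sqrt c)%:E.
Proof.
move=> C1 gc.
(* The path is a single arc followed by the empty path, whose length is the added 0. *)
have <- : (curve_length 0 1 g + 0)%E = (Num.sqrt c)%:E.
  rewrite adde0 /curve_length.
  rewrite (eq_integral (cst (Num.sqrt c)%:E)); last first.
    move=> t; rewrite inE/= in_itv/= => t01.
    by rewrite /tnorm -(gc t t01).
  rewrite integral_cst//= lebesgue_measure_itv/= lte_fin ltr01.
  by rewrite oppr0 adde0 mule1.
by apply: path_length_cons => //; exact: path_length_nil.
Qed.

Lemma path_length_exp p (v : tangent p) : exp_domain v ->
  path_length p (exp_at v) (tnorm v)%:E /\
  path_length (exp_at v) p (tnorm v)%:E.
Proof.
move=> [g0 g0v].
(* Since [v] is in [exp_domain], [exp_at v] is the endpoint [g 1] of an actual geodesic, not the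
   default [p]. *)
have [g [[e e0 geo] gp gv] <-] :
    [set g 1 | g in [set g | exp_curve v g]] (exp_at v).
  by apply: xgetPex; exists (g0 1), g0.
(* The margin [e] places [0, 1] inside the open interval of the geodesic. *)
have C1 : C1_curve 0 1 g by apply: geodesic_C1 geo _ _; lra.
have speed0 : speed2 g 0 = bilin (metric (chart_at p) (phi (chart_at p) p)) v v.
  by rewrite /speed2 /velocity gp gv.
have speed t : 0 <= t <= 1 -> speed2 g t =
    bilin (metric (chart_at p) (phi (chart_at p) p)) v v.
  move=> t01; rewrite -speed0; move: t01 => /andP[t0 t1].
  by apply: geodesic_speed2_cst geo _ t0 _; lra.
split.
  by rewrite -[X in path_length X]gp; exact: path_length_cst_speed.
rewrite -[X in path_length _ X]gp.
have := path_length_cst_speed (reverse g) _ (C1_curve_reverse g C1).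
rewrite /reverse subr0 subrr; apply=> t t01.
rewrite (speed2_reverse _ _ C1 t01); apply: speed; move: t01; lra.
Qed.

Lemma path_length_trans p q r (l m : \bar R) :
  path_length p q l -> path_length q r m -> path_length p r (l + m)%E.
Proof.
elim=> [{}p|a b g {}q {}l ab C1 _ IH] qr; first by rewrite add0e.
by rewrite -addeA; apply: path_length_cons => //; exact: IH.
Qed.

Lemma path_length_ge0 p q (l : \bar R) : path_length p q l -> (0 <= l)%E.
Proof.
elim=> // a b g {}q {}l _ _ _ l0; apply: adde_ge0 => //.
by apply: integral_ge0 => t _; rewrite lee_fin sqrtr_ge0.
Qed.

Lemma rho_ge0 p q : (0 <= rho p q)%E.
Proof. by apply: le_ereal_inf_tmp => l; exact: path_length_ge0. Qed.

(** Every path from p' to q' extends to one from p to q by the two given paths. As [l] and [m] are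
    finite, they can be moved across the inequality before passing to the infimum, even if the
    distance is infinite. *)
Lemma rho_le_detour p q p' q' (l m : R) :
  path_length p p' l%:E -> path_length q' q m%:E ->
  (rho p q <= rho p' q' + (l + m)%:E)%E.
Proof.
move=> pp' qq'; rewrite -leeBlDr//; apply: le_ereal_inf_tmp => k pq'.
rewrite leeBlDr// EFinD addeCA; apply: ereal_inf_lbound => /=.
exact: path_length_trans pp' (path_length_trans _ _ _ _ _ pq' qq').
Qed.

End Lengths.

(** * From one synthesis step to the stability of the pyramid *)

Section Stability.
Context {R : realType} {n : nat} {M : riemannianManifold R n}.
Implicit Types (P : pyramid M) (c m : int -> M) (d : int -> tangent_vector M).

(** The detour runs along the reversed geodesic to p, on to q, then along the geodesic to
    exp_q(w). *)
Lemma rho_oplus (p q : M) (v w : tangent_vector M) :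
  foot v = p -> exp_domain (vec v) -> foot w = q -> exp_domain (vec w) ->
  (rho (oplus p v) (oplus q w) <= rho p q + (tvnorm v + tvnorm w))%E.
Proof.
move=> <- /path_length_exp[_ vp] <- /path_length_exp[qw _].
by rewrite /tvnorm -EFinD; exact: rho_le_detour.
Qed.

Lemma mu_ge0 c m : (0 <= mu c m)%E.
Proof.
by apply: le_trans (rho_ge0 (c 0) (m 0)) _; apply: ereal_sup_ubound; exists 0.
Qed.

Lemma supnorm_ge0 d : (0 <= supnorm d)%E.
Proof.
have d0 : (0 <= tvnorm (d 0%R))%E by rewrite lee_fin sqrtr_ge0.
by apply: le_trans d0 _; apply: ereal_sup_ubound; exists 0.
Qed.

Lemma mu_oplus alpha c m d e :
  (forall k, foot (d k) = refine alpha c k /\ exp_domain (vec (d k))) ->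
  (forall k, foot (e k) = refine alpha m k /\ exp_domain (vec (e k))) ->
  (mu (fun k => oplus (refine alpha c k) (d k))
      (fun k => oplus (refine alpha m k) (e k)) <=
   mu (refine alpha c) (refine alpha m) + (supnorm d + supnorm e))%E.
Proof.
move=> dP eP; apply: ge_ereal_sup => _ [k _ <-].
have [[df dd] [ef ed]] := (dP k, eP k).
apply: le_trans (rho_oplus _ _ _ _ df dd ef ed) _.
by rewrite !leeD//; apply: ereal_sup_ubound; exists k.
Qed.

Lemma mu_synthesis alpha (S T : R) P Q J :
  stable M alpha S -> S <= T -> 1 <= T ->
  pyramid_ok alpha P J -> pyramid_ok alpha Q J ->
  (mu (synthesis alpha P J) (synthesis alpha Q J) <=
   (T ^+ J)%:E * (mu (coarse P) (coarse Q) +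
     \sum_(1 <= i < J.+1) (supnorm (details P i) + supnorm (details Q i))))%E.
Proof.
move=> [S0 stab] ST T1; elim: J => [_ _|J IH okP okQ].
  by rewrite big_nil adde0 expr0 mul1e.
have {}IH := IH (fun l lJ => okP l (ltnW lJ)) (fun l lJ => okQ l (ltnW lJ)).
have [admP dP] := okP J (ltnSn J); have [admQ dQ] := okQ J (ltnSn J).
rewrite big_nat_recr//= addeA.
set A := (mu _ _ + \sum_(1 <= i < J.+1) _)%E in IH *.
set D := (supnorm _ + supnorm _)%E.
have T0 : 0 <= T by exact: le_trans T1.
have A0 : (0 <= A)%E.
  by rewrite adde_ge0 ?mu_ge0// sume_ge0// => i _; rewrite adde_ge0// supnorm_ge0.
have D0 : (0 <= D)%E by rewrite adde_ge0// supnorm_ge0.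
(* [A] bounds the data up to level [J] and [D] the details of the last level; [D] enters the factor
   because [T ^+ J.+1 >= 1]. *)
apply: (@le_trans _ _ ((T ^+ J.+1)%:E * A + D)%E); last first.
  clearbody A D; rewrite ge0_muleDr// leeD2l// -[leLHS]mul1e lee_wpmul2r// lee_fin.
  exact: exprn_ege1.
apply: (@le_trans _ _
    (mu (refine alpha (synthesis alpha P J)) (refine alpha (synthesis alpha Q J))
      + D)%E).
  by apply: mu_oplus => k; [have [? ? _] := dP k|have [? ? _] := dQ k].
rewrite leeD2r//.
(* Stability speaks only of sequences at finite distance. If the distance is infinite, the induction
   hypothesis forces [T ^+ J * A] to be infinite, and so is the right-hand side since [T > 0]. *)
have [fin|] := ltP (mu (synthesis alpha P J) (synthesis alpha Q J)) +oo%E.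
  apply: le_trans (stab _ _ admP admQ fin) _.
  rewrite exprS EFinM -muleA lee_pmul ?lee_fin//; exact: mu_ge0.
rewrite leye_eq => /eqP muoo; move: IH; rewrite muoo leye_eq => /eqP TAoo.
by rewrite exprS EFinM -muleA TAoo gt0_muley ?leey// lte_fin (lt_le_trans ltr01).
Qed.

End Stability.

Theorem theorem5p7 (R : realType) (n : nat) (M : riemannianManifold R n)
    (alpha : int -> R) (ST : R) (J : nat) (P Pt : pyramid M) :
  subdivision_mask alpha ->
  stable M alpha ST ->
  pyramid_ok alpha P J ->
  pyramid_ok alpha Pt J ->
  let L : R := if ST <= 1 then 1 else ST ^+ J in
  (mu (synthesis alpha P J) (synthesis alpha Pt J) <=
   L%:E * (mu (coarse P) (coarse Pt) +
           \sum_(1 <= i < J.+1)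
             (supnorm (details P i) + supnorm (details Pt i))))%E.
Proof.
move=> _ stab okP okPt; lazy zeta.
(* Both cases of [L] are powers of one constant that is at least [ST] and at least 1. *)
have -> : (if ST <= 1 then 1 else ST ^+ J) = Num.max ST 1 ^+ J.
  by case: leP => _ //; rewrite expr1n.
by apply: mu_synthesis stab _ _ okP okPt; rewrite le_max lexx ?orbT.
Qed.
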